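(* Let $G$ be a Lie group with a two-dimensional derived subalgebra, $g=\langle\cdot,\cdot\rangle$ a left-invariant Riemannian metric on $G$, and $\tilde g$ the lifted left-invariant metric on $TG$. With the notation of the context, the sectional curvatures $\tilde K$ of $(TG,\tilde g)$ satisfy, for every orthonormal subset $\{u,v\}$ of $\mathcal P$: $$\tilde K(e_1^c,e_2^c)=\tilde K(e_1^v,e_2^v)=\tfrac14\|a_2+b_1\|^2-\langle a_1,b_2\rangle,\qquad \tilde K(e_1^c,e_2^v)=\tfrac14\|a_2\|^2-\langle a_1,b_2\rangle,$$ $$\tilde K(e_1^c,e_1^v)=-\tfrac34\|a_1\|^2,\qquad \tilde K(e_1^v,e_2^c)=\tfrac14\|b_1\|^2-\langle a_1,b_2\rangle,$$ $$\tilde K(e_2^c,e_2^v)=-\tfrac34\|b_2\|^2,\qquad \tilde K(u^v,v^v)=\tilde K(u^c,u^v)=0,$$ $$\tilde K(u^c,v^c)=\tilde K(u^c,v^v)=-\tfrac34\left(\langle f_1(u),v\rangle^2+\langle f_2(u),v\rangle^2\right),$$ $$\tilde K(u^c,e_1^c)=\tilde K(u^c,e_1^v)=\tfrac14\|f_1(u)\|^2-\langle a_1,u\rangle^2+\tfrac14\langle u,a_2+b_1\rangle\langle u,b_1-3a_2\rangle,$$ $$\tilde K(u^c,e_2^c)=\tilde K(u^c,e_2^v)=\tfrac14\|f_2(u)\|^2-\langle b_2,u\rangle^2+\tfrac14\langle u,a_2+b_1\rangle\langle u,a_2-3b_1\rangle,$$ $$\tilde K(u^v,e_1^c)=-\tfrac34\left(\langle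 a_1,u\rangle^2+\langle a_2,u\rangle^2\right),\qquad \tilde K(u^v,e_1^v)=\tfrac14\left(\|f_1(u)\|^2+\langle a_1,u\rangle^2+\langle b_1,u\rangle^2\right),$$ $$\tilde K(u^v,e_2^c)=-\tfrac34\left(\langle b_1,u\rangle^2+\langle b_2,u\rangle^2\right),\qquad \tilde K(u^v,e_2^v)=\tfrac14\left(\|f_2(u)\|^2+\langle a_2,u\rangle^2+\langle b_2,u\rangle^2\right).$$
   Context: $G$ is a connected $n$-dimensional real Lie group with Lie algebra $\mathfrak g$ (left-invariant vector fields) such that $\mathfrak g'=[\mathfrak g,\mathfrak g]$ has dimension $2$ (equivalently, the commutator subgroup is two-dimensional). $g$ is a left-invariant Riemannian metric on $G$, with induced inner product $\langle\cdot,\cdot\rangle$ on $\mathfrak g$ and $\|\cdot\|^2=\langle\cdot,\cdot\rangle$. $\{e_1,e_2\}$ is an orthonormal basis of $\mathfrak g'$ and $\mathcal P$ is the $(n-2)$-dimensional orthogonal complement of $\mathfrak g'$ in $\mathfrak g$. The vectors $a_1,a_2,b_1,b_2\in\mathcal P$ and skew-symmetric linear maps $f_1,f_2:\mathcal P\to\mathcal P$ are uniquely determined by: for all $u,v\in\mathcal P$, $[u,e_1]=\langle a_1,u\rangle e_1+\langle a_2,u\rangle e_2$, $[u,e_2]=\langle b_1,u\rangle e_1+\langle b_2,u\rangle e_2$, $[u,v]=\langle f_1(u),v\rangle e_1+\langle f_2(u),v\rangle e_2$. $TG$ is a Lie group with the tangent map $T\mu$ of the multiplication $\mu$ as product. For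 a vector field $X$ on $G$, the vertical lift $X^v$ is the infinitesimal generator on $TG$ of the flow $y\mapsto y+tX(x)$, $y\in T_xG$, and the complete lift $X^c$ is the infinitesimal generator of $T\phi_t$, where $\phi_t$ is the (local) flow of $X$. Lifts of left-invariant fields are left-invariant on $TG$, with $[X^c,Y^c]=[X,Y]^c$, $[X^c,Y^v]=[X,Y]^v$, $[X^v,Y^v]=0$. The lifted left-invariant metric $\tilde g$ on $TG$ is defined by $\tilde g(X^c,Y^c)=\tilde g(X^v,Y^v)=g(X,Y)$, $\tilde g(X^c,Y^v)=0$ for $X,Y\in\mathfrak g$. $\tilde K(A,B)$ is the sectional curvature of the plane spanned by $A,B$. *)

(* Defs.v *)
From HB Require Import structures.
From mathcomp Require Import all_boot all_order all_algebra.
From mathcomp Require Import lra boolp reals.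

Set Implicit Arguments.
Unset Strict Implicit.
Unset Printing Implicit Defensive.

Import Order.TTheory GRing.Theory Num.Theory.
Local Open Scope ring_scope.

(* A left-invariant metric on a Lie group is encoded, as usual, by a metric Lie
   algebra: the Lie algebra V of left-invariant vector fields with its bracket
   and the inner product induced by the metric. *)

HB.mixin Record isLieBracket (R : nzRingType) (V : lmodType R)
    (br : V -> V -> V) := {
  lie_alternating : forall x, br x x = 0;
  lie_jacobi : forall x y z,
    br x (br y z) + br y (br z x) + br z (br x y) = 0
}.

#[short(type="lieBracket")]
HB.structure Definition LieBracket (R : nzRingType) (V : lmodType R) :=
  {br of isLieBracket R V br & @Bilinear R V V V *:%R *:%R br}.

Notation "{ 'lie' V }" := (@LieBracket.type _ V)
  (at level 0, format "{ 'lie'  V }") : ring_scope.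

Section MetricLieAlgebra.
Context {R : realType} {V : vectType R}.
Variables (br : {lie V}) (ip : {dot V for idfun}).

Definition derived : {vspace V} :=
  <<[seq br x y | x <- vbasis fullv, y <- vbasis fullv]>>%VS.

Lemma lie_anti x y : br x y = - br y x.
Proof.
apply/eqP; rewrite -addr_eq0; apply/eqP.
have := lie_alternating (s := br) (x + y).
by rewrite linearDl !linearDr /= !lie_alternating add0r addr0.
Qed.

Lemma dotC x y : ip x y = ip y x.
Proof. by rewrite hermC expr0 mul1r. Qed.

Lemma mem_derived x y : br x y \in derived.
Proof.
rewrite (coord_vbasis (memvf x)) (coord_vbasis (memvf y)).
rewrite linear_sumlz rpred_sum // => i _; rewrite linearZl_LR linear_sumr.
rewrite rpredZ // rpred_sum // => j _; rewrite linearZr_LR rpredZ //.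
by apply/memv_span/allpairsP; exists ((vbasis fullv)`_i, (vbasis fullv)`_j);
  rewrite !mem_nth ?size_tuple.
Qed.

Lemma derived_min (U : {vspace V}) :
  (forall x y, br x y \in U) -> (derived <= U)%VS.
Proof. by move=> brU; apply/span_subvP => _ /allpairsP[[x y] [_ _ ->]]. Qed.

Definition derived_perp : {vspace V} := orthov ip derived.

Definition dot_on (U : {vspace V}) (x y : subvs_of U) : R :=
  ip (vsval x) (vsval y).

(* The restriction of the Levi-Civita connection to left-invariant fields.
   Inner products of left-invariant fields are constant, so compatibility with
   the metric has no derivative term. *)
Definition levi_civita (nabla : {bilinear V -> V -> V}) : Prop :=
  (forall x y, nabla x y - nabla y x = br x y) /\
  (forall x y z, ip (nabla x y) z + ip y (nabla x z) = 0).

Definition koszul x y z : R :=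
  2^-1 * (ip (br x y) z - ip (br y z) x + ip (br z x) y).

Lemma dot_inj x y : (forall z, ip x z = ip y z) -> x = y.
Proof.
move=> e; apply/eqP; rewrite -subr_eq0; apply: contraT => /neq0_dnorm_gt0.
by move=> /(_ _ ip); rewrite linearBl /= e subrr ltxx.
Qed.

Lemma riesz (f : {linear V -> R^o}) : exists x, forall z, ip x z = f z.
Proof.
pose b := vbasis {:V}.
have coordE z : z = \sum_i coord b i z *: b`_i.
  exact: coord_vbasis (memvf z).
pose G : 'M[R]_(\dim {:V}) := \matrix_(i, j) ip b`_i b`_j.
pose comb (w : 'rV_(\dim {:V})) := \sum_i w 0 i *: b`_i.
have ipG w z : ip (comb w) z = \sum_j (w *m G) 0 j * coord b j z.
  rewrite [in LHS](coordE z) linear_sumr; apply: eq_bigr => j _.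
  rewrite linearZr_LR /= mulrC; congr (_ * _).
  rewrite linear_sumlz mxE; apply: eq_bigr => i _.
  by rewrite linearZl_LR /= mxE.
have Gu : G \in unitmx.
  rewrite -row_free_unit -kermx_eq0; apply/rowV0P => w /sub_kermxP wG.
  have /freeP fb : free b by exact: basis_free (vbasisP _).
  have /(fb (w 0)) w0 : comb w = 0.
    apply: dot_inj => z; rewrite ipG wG linear0l big1 // => j _.
    by rewrite mxE mul0r.
  by apply/rowP => i; rewrite w0 mxE.
exists (comb (\row_j f b`_j *m invmx G)) => z.
rewrite ipG mulmxKV // [in RHS](coordE z) linear_sum; apply: eq_bigr => j _.
by rewrite mxE linearZ /= mulrC.
Qed.

Lemma levi_civita_koszul (nabla : {bilinear V -> V -> V}) :
  levi_civita nabla -> forall x y z, ip (nabla x y) z = koszul x y z.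
Proof.
move=> [tf mt] x y z; rewrite /koszul -!tf !linearBl /=.
have := (mt x y z, mt y z x, mt z x y).
rewrite ![ip _ (nabla _ _)]dotC => -[[]]; lra.
Qed.

Lemma levi_civita_unique (nabla nabla' : {bilinear V -> V -> V}) :
  levi_civita nabla -> levi_civita nabla' -> nabla =2 nabla'.
Proof.
by move=> h h' x y; apply: dot_inj => z; rewrite !levi_civita_koszul.
Qed.

Lemma levi_civita_exists :
  exists nabla : {bilinear V -> V -> V}, levi_civita nabla.
Proof.
have koszulP x y : exists w, forall z, ip w z = koszul x y z.
  have lin : linear (koszul x y : V -> R^o).
    move=> a z z'; rewrite /koszul /GRing.scale /=.
    rewrite !linearDr !linearDl !linearZr_LR !linearZl_LR /=.
    rewrite ?linearZl_LR /=; lra.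
  pose m := GRing.isLinear.Build _ _ _ _ _ lin.
  exact: (riesz (HB.pack_for {linear V -> R^o} (koszul x y : V -> R^o) m)).
pose nab x y := sval (cid (koszulP x y)).
have nabE x y z : ip (nab x y) z = koszul x y z.
  exact: (proj2_sig (cid (koszulP x y))).
have bil : bilinear_for *:%R *:%R nab.
  split=> [y|x] a u v; apply: dot_inj => z.
    rewrite linearDl linearZl_LR /= !nabE /koszul.
    rewrite !linearDr !linearDl !linearZr_LR !linearZl_LR /=.
    rewrite ?linearZl_LR ?linearZr_LR /=; lra.
  rewrite linearDl linearZl_LR /= !nabE /koszul.
  rewrite !linearDr !linearDl !linearZr_LR !linearZl_LR /=.
  rewrite ?linearZl_LR /=; lra.
pose m := bilinear_isBilinear.Build _ _ _ _ _ _ _ bil.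
exists (HB.pack_for {bilinear V -> V -> V} nab m); split=> [x y|x y z] /=.
  apply: dot_inj => z; rewrite linearBl /= !nabE /koszul.
  by rewrite (lie_anti y x) (lie_anti x z) (lie_anti z y) !linearNl /=; lra.
rewrite [ip y _]dotC !nabE /koszul.
by rewrite (lie_anti y x) (lie_anti x z) (lie_anti z y) !linearNl /=; lra.
Qed.

Definition connection : {bilinear V -> V -> V} := sval (cid levi_civita_exists).

Lemma connectionP : levi_civita connection.
Proof. exact: svalP. Qed.

Definition curvature x y z : V :=
  connection x (connection y z) - connection y (connection x z)
  - connection (br x y) z.

Definition sectional_curvature x y : R :=
  ip (curvature x y y) x / (ip x x * ip y y - ip x y ^+ 2).

End MetricLieAlgebra.

Section TangentGroup.
Context {R : realType} {V : vectType R}.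

(* The Lie algebra of TG: a pair (x, y) stands for x^c + y^v. *)
Definition clift (x : V) : V * V := (x, 0).
Definition vlift (x : V) : V * V := (0, x).

Definition tangent_bracket (br : V -> V -> V) (A B : V * V) : V * V :=
  (br A.1 B.1, br A.1 B.2 + br A.2 B.1).

Definition lifted_metric (ip : V -> V -> R) (A B : V * V) : R :=
  ip A.1 B.1 + ip A.2 B.2.

Variables (br : {lie V}) (ip : {dot V for idfun}).

Lemma tangent_bracket_bilinear :
  bilinear_for *:%R *:%R (tangent_bracket br).
Proof.
split=> [C|A] a [x y] [x' y']; congr (_, _) => /=.
- exact: linearPl.
- rewrite !linearPl /=.
  by rewrite scalerDr addrACA.
- exact: linearPr.
- rewrite !linearPr /=.
  by rewrite scalerDr addrACA.
Qed.
HB.instance Definition _ := bilinear_isBilinear.Build R _ _ _ _ _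
  (tangent_bracket br) tangent_bracket_bilinear.

Lemma tangent_bracket_alternating A : tangent_bracket br A A = 0.
Proof.
rewrite /tangent_bracket !lie_alternating (lie_anti br A.2).
by rewrite subrr.
Qed.

Lemma tangent_bracket_jacobi A B C :
  tangent_bracket br A (tangent_bracket br B C)
  + tangent_bracket br B (tangent_bracket br C A)
  + tangent_bracket br C (tangent_bracket br A B) = 0.
Proof.
case: A B C => [x x'] [y y'] [z z']; congr (_, _) => /=.
  exact: lie_jacobi.
rewrite !linearDr /=.
rewrite (AC (3*3*3) ((1*5*9)*(2*6*7)*(3*4*8))) /=.
by rewrite !lie_jacobi !addr0.
Qed.
HB.instance Definition _ := isLieBracket.Build R _ (tangent_bracket br)
  tangent_bracket_alternating tangent_bracket_jacobi.

Lemma lifted_metric_bilinear :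
  bilinear_for *%R (idfun \; *%R) (lifted_metric ip).
Proof.
split=> [C|A] a X Y; rewrite /lifted_metric /= !(linearDl, linearDr) /=.
  by rewrite !linearZl_LR /= mulrDr addrACA.
by rewrite !linearZr_LR /= mulrDr addrACA.
Qed.
HB.instance Definition _ := bilinear_isBilinear.Build R _ _ _ _ _
  (lifted_metric ip) lifted_metric_bilinear.

Lemma lifted_metric_sym A B :
  lifted_metric ip A B = (-1) ^+ false * idfun (lifted_metric ip B A).
Proof.
by rewrite expr0 mul1r /lifted_metric dotC [ip A.2 _]dotC.
Qed.
HB.instance Definition _ := isHermitianSesquilinear.Build R _ false idfun
  (lifted_metric ip) lifted_metric_sym.

Lemma lifted_metric_gt0 A : A != 0 -> 0 < lifted_metric ip A A.
Proof.
have ge0 x : 0 <= ip x x.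
  have [->|/neq0_dnorm_gt0 x0] := eqVneq x 0; first by rewrite linear0l.
  exact/ltW/x0.
case: A => x y; rewrite /lifted_metric /= xpair_eqE negb_and => /orP[] nz.
  by rewrite ltr_wpDr // neq0_dnorm_gt0.
by rewrite ltr_wpDl // neq0_dnorm_gt0.
Qed.
HB.instance Definition _ := isDotProduct.Build R _
  (lifted_metric ip) lifted_metric_gt0.

Lemma bracket_cc x y :
  tangent_bracket br (clift x) (clift y) = clift (br x y).
Proof. by congr (_, _); rewrite /= linear0l linear0r addr0. Qed.

Lemma bracket_cv x y :
  tangent_bracket br (clift x) (vlift y) = vlift (br x y).
Proof. by congr (_, _); rewrite /= ?linear0l ?linear0r ?addr0. Qed.

Lemma bracket_vv x y : tangent_bracket br (vlift x) (vlift y) = 0.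
Proof. by congr (_, _); rewrite /= ?linear0l ?linear0r ?addr0. Qed.

Lemma lifted_metric_cc x y : lifted_metric ip (clift x) (clift y) = ip x y.
Proof. by rewrite /lifted_metric /= linear0l addr0. Qed.

Lemma lifted_metric_vv x y : lifted_metric ip (vlift x) (vlift y) = ip x y.
Proof. by rewrite /lifted_metric /= linear0l add0r. Qed.

Lemma lifted_metric_cv x y : lifted_metric ip (clift x) (vlift y) = 0.
Proof. by rewrite /lifted_metric /= linear0l linear0r addr0. Qed.

Definition lifted_curvature : V * V -> V * V -> R :=
  sectional_curvature (tangent_bracket br) (lifted_metric ip).

End TangentGroup.

(* Main.v *)
Require Import Defs.
From HB Require Import structures.
From mathcomp Require Import all_boot all_order all_algebra.
From mathcomp Require Import reals lra.

Set Implicit Arguments.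
Unset Strict Implicit.
Unset Printing Implicit Defensive.

Import GRing.Theory Num.Theory.
Local Open Scope ring_scope.

(** For a left-invariant metric everything is algebra in the Lie algebra, and
    the sectional curvature only needs two ingredients: the bracket and the
    coadjoint vectors T(x, y), defined by <T(x, y), z> = <[z, x], y>. Indeed
    Koszul's formula says 2 nabla_x y = [x, y] + T(x, y) + T(y, x), and then,
    for x, y orthonormal (sectional_curvature_orthonormal),

      K(x, y) = |T(x, y) + T(y, x)|^2 / 4 - <T(x, x), T(y, y)>
                - 3/4 |[x, y]|^2 - <[x, [x, y]], y> / 2 - <[y, [y, x]], x> / 2.

    Coadjoint vectors lift to TG in the simplest way (coadjoint_cc to
    coadjoint_vc): T(x^c, y^c) = T(x^v, y^v) = T(x, y)^c,
    T(x^c, y^v) = T(x, y)^v and T(x^v, y^c) = 0. So each curvature of the lifted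
    metric is an expression in the bracket and the coadjoint vectors of the base
    (lifted_curvature_cc, _vv, _cv and _vc).

    What remains is the table of T on the base. For u orthogonal to g', T(x, u)
    vanishes, since all brackets lie in g'. Moreover g' is abelian
    (derived_abelian), because z |-> tr (ad z | g') kills brackets, hence kills
    g'. It follows that T(e_i, e_j) is orthogonal to g', and it can be read off
    as a1, a2, b1 or b2 (coadjoint_plane). Finally
    T(u, e1) = - (f1 u + <a1, u> e1 + <b1, u> e2), where the skew-symmetry of f1
    enters. Exchanging e1 and e2 exchanges a1 with b2, a2 with b1 and f1 with f2
    (derived_frame_swap), so the formulas for e2 follow from those for e1. *)

(** * Sectional curvature through coadjoint vectors *)

Section Curvature.
Context {R : realType} {V : vectType R}.
Variables (br : {lie V}) (ip : {dot V for idfun}).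
Implicit Types x y z s t p q : V.

(** That t equals - (ad x)^* y, the metric adjoint of ad x. A relation, rather
    than a function, lets the vector be given by any explicit candidate. *)
Definition coadjoint x y t : Prop := forall z, ip t z = ip (br z x) y.

Lemma connection_add x y s t :
  coadjoint x y s -> coadjoint y x t ->
  connection br ip x y = 2^-1 *: (br x y + s + t).
Proof.
move=> xys yxt; apply: (dot_inj (ip := ip)) => z.
rewrite (levi_civita_koszul (connectionP br ip)) /koszul linearZl_LR /=.
by rewrite !linearDl /= xys yxt (lie_anti br z y) linearNl /=; lra.
Qed.

(** Metric compatibility moves the outer derivatives of
    nabla_x (nabla_y y) - nabla_y (nabla_x y) to the other argument, leaving
    <nabla_x y, nabla_y x> - <nabla_y y, nabla_x x>. The first product is a
    difference of squares since nabla_x y and nabla_y x are half of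
    s + t plus, respectively minus, [x, y]. *)
Lemma curvature_coadjoint x y p q s t :
  coadjoint x x p -> coadjoint y y q -> coadjoint x y s -> coadjoint y x t ->
  ip (curvature br ip x y y) x =
    1 / 4 * ip (s + t) (s + t) - ip p q - 3 / 4 * ip (br x y) (br x y)
    - 1 / 2 * ip (br x (br x y)) y - 1 / 2 * ip (br y (br y x)) x.
Proof.
move=> hp hq hs ht; have [_ mt] := connectionP br ip.
have nxx : connection br ip x x = p.
  apply: (dot_inj (ip := ip)) => z.
  rewrite (connection_add hp hp) lie_alternating add0r.
  by rewrite linearZl_LR linearDl /=; lra.
have nyy : connection br ip y y = q.
  apply: (dot_inj (ip := ip)) => z.
  rewrite (connection_add hq hq) lie_alternating add0r.
  by rewrite linearZl_LR linearDl /=; lra.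
rewrite /curvature !linearBl /=.
have := mt x (connection br ip y y) x.
have := mt y (connection br ip x y) x.
have := levi_civita_koszul (connectionP br ip) (br x y) y x.
rewrite nxx nyy (connection_add hs ht) (connection_add ht hs) /koszul.
rewrite (lie_anti br (br x y) y) (lie_anti br y x) !(linearNr, linearNl) /=.
rewrite !(linearZl_LR, linearZr_LR) /=.
rewrite !(linearDl, linearDr, linearNl, linearNr) /=.
rewrite [ip q p]dotC [ip s (br x y)]dotC [ip t (br x y)]dotC [ip t s]dotC.
lra.
Qed.

Lemma sectional_curvature_orthonormal x y p q s t :
  ip x x = 1 -> ip y y = 1 -> ip x y = 0 ->
  coadjoint x x p -> coadjoint y y q -> coadjoint x y s -> coadjoint y x t ->
  sectional_curvature br ip x y =
    1 / 4 * ip (s + t) (s + t) - ip p q - 3 / 4 * ip (br x y) (br x y)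
    - 1 / 2 * ip (br x (br x y)) y - 1 / 2 * ip (br y (br y x)) x.
Proof.
move=> xx yy xy hp hq hs ht.
by rewrite /sectional_curvature xx yy xy mulr1 expr0n subr0 divr1
  (curvature_coadjoint hp hq hs ht).
Qed.

End Curvature.

(** * Lifting to the tangent group *)

Section Lifts.
Context {R : realType} {V : vectType R}.
Variables (br : {lie V}) (ip : {dot V for idfun}).
Implicit Types x y z s t p q : V.

Local Notation lifted_coadjoint :=
  (coadjoint (tangent_bracket br) (lifted_metric ip)).

Lemma coadjoint_cc x y t :
  coadjoint br ip x y t -> lifted_coadjoint (clift x) (clift y) (clift t).
Proof.
move=> h [z z'] /=; rewrite /lifted_metric /= h !(linear0l, linear0r) /=.
by rewrite !addr0.
Qed.

Lemma coadjoint_vv x y t :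
  coadjoint br ip x y t -> lifted_coadjoint (vlift x) (vlift y) (clift t).
Proof.
move=> h [z z'] /=; rewrite /lifted_metric /= h !(linear0l, linear0r) /=.
by rewrite !addr0 add0r.
Qed.

Lemma coadjoint_cv x y t :
  coadjoint br ip x y t -> lifted_coadjoint (clift x) (vlift y) (vlift t).
Proof.
move=> h [z z'] /=; rewrite /lifted_metric /= h !(linear0l, linear0r) /=.
by rewrite !add0r.
Qed.

Lemma coadjoint_vc x y : lifted_coadjoint (vlift x) (clift y) 0.
Proof.
by move=> [z z'] /=; rewrite /lifted_metric /= !(linear0l, linear0r) /= !addr0.
Qed.

(** For two complete lifts the base formula is unchanged. Vertical lifts lose
    terms: their brackets with each other vanish, and in a mixed plane only one
    of the two coadjoint vectors is nonzero. *)
Section Pair.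
Variables (x y p q s t : V).
Hypotheses (hp : coadjoint br ip x x p) (hq : coadjoint br ip y y q).
Hypotheses (hs : coadjoint br ip x y s) (ht : coadjoint br ip y x t).
Hypotheses (xx : ip x x = 1) (yy : ip y y = 1).

Let xx_c := etrans (lifted_metric_cc ip x x) xx.
Let xx_v := etrans (lifted_metric_vv ip x x) xx.
Let yy_c := etrans (lifted_metric_cc ip y y) yy.
Let yy_v := etrans (lifted_metric_vv ip y y) yy.

Lemma lifted_curvature_cc : ip x y = 0 ->
  lifted_curvature br ip (clift x) (clift y) =
    1 / 4 * ip (s + t) (s + t) - ip p q - 3 / 4 * ip (br x y) (br x y)
    - 1 / 2 * ip (br x (br x y)) y - 1 / 2 * ip (br y (br y x)) x.
Proof.
move=> xy; have xy_c := etrans (lifted_metric_cc ip x y) xy.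
rewrite /lifted_curvature (sectional_curvature_orthonormal xx_c yy_c xy_c
  (coadjoint_cc hp) (coadjoint_cc hq) (coadjoint_cc hs) (coadjoint_cc ht)).
rewrite /= /lifted_metric /tangent_bracket /=.
by rewrite !(linear0l, linear0r, addr0, add0r, mulr0, subr0).
Qed.

Lemma lifted_curvature_vv : ip x y = 0 ->
  lifted_curvature br ip (vlift x) (vlift y) =
    1 / 4 * ip (s + t) (s + t) - ip p q.
Proof.
move=> xy; have xy_v := etrans (lifted_metric_vv ip x y) xy.
rewrite /lifted_curvature (sectional_curvature_orthonormal xx_v yy_v xy_v
  (coadjoint_vv hp) (coadjoint_vv hq) (coadjoint_vv hs) (coadjoint_vv ht)).
rewrite /= /lifted_metric /tangent_bracket /=.
by rewrite !(linear0l, linear0r, addr0, add0r, mulr0, subr0).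
Qed.

Lemma lifted_curvature_cv :
  lifted_curvature br ip (clift x) (vlift y) =
    1 / 4 * ip s s - ip p q - 3 / 4 * ip (br x y) (br x y)
    - 1 / 2 * ip (br x (br x y)) y.
Proof.
have xy_cv := lifted_metric_cv ip x y.
rewrite /lifted_curvature (sectional_curvature_orthonormal xx_c yy_v xy_cv
  (coadjoint_cc hp) (coadjoint_vv hq) (coadjoint_cv hs) (@coadjoint_vc y x)).
rewrite /= /lifted_metric /tangent_bracket /=.
by rewrite !(linear0l, linear0r, addr0, add0r, mulr0, subr0).
Qed.

Lemma lifted_curvature_vc :
  lifted_curvature br ip (vlift x) (clift y) =
    1 / 4 * ip t t - ip p q - 3 / 4 * ip (br x y) (br x y)
    - 1 / 2 * ip (br y (br y x)) x.
Proof.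
have xy_vc := etrans (dotC (lifted_metric ip) _ _) (lifted_metric_cv ip y x).
rewrite /lifted_curvature (sectional_curvature_orthonormal xx_v yy_c xy_vc
  (coadjoint_vv hp) (coadjoint_cc hq) (@coadjoint_vc x y) (coadjoint_cv ht)).
rewrite /= /lifted_metric /tangent_bracket /=.
by rewrite !(linear0l, linear0r, addr0, add0r, mulr0, subr0).
Qed.

End Pair.
End Lifts.

(** * A two-dimensional derived algebra *)

Section DerivedPlane.
Context {R : realType} {V : vectType R}.
Variables (br : {lie V}) (ip : {dot V for idfun}).

Lemma derived_vanish (f : {linear V -> R^o}) :
  (forall x y, f (br x y) = 0) -> {in derived br, forall z, f z = 0}.
Proof.
move=> f0 z; suff /subvP le : (derived br <= lker (linfun f))%VS.
  by move=> /le; rewrite memv_ker lfunE => /eqP.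
by apply: derived_min => x y; rewrite memv_ker lfunE /= f0.
Qed.

Variables e1 e2 : V.
Hypothesis e_basis : basis_of (derived br) [:: e1; e2].
Hypothesis e_orthonormal : orthonormal ip [:: e1; e2].

Lemma frame11 : ip e1 e1 = 1.
Proof.
by move: e_orthonormal; rewrite /orthonormal /= => /andP[/andP[/eqP]].
Qed.

Lemma frame22 : ip e2 e2 = 1.
Proof.
by move: e_orthonormal; rewrite /orthonormal /= => /andP[/and3P[_ /eqP]].
Qed.

Lemma frame12 : ip e1 e2 = 0.
Proof.
by move: e_orthonormal; rewrite /orthonormal /= !andbT => /andP[_ /eqP].
Qed.

Lemma frame21 : ip e2 e1 = 0. Proof. by rewrite dotC frame12. Qed.

Definition frameE := (frame11, frame22, frame12, frame21).

Lemma span_frame z :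
  z \in derived br -> exists c1 c2, z = c1 *: e1 + c2 *: e2.
Proof.
rewrite -(span_basis e_basis) span_cons span_seq1.
by move=> /memv_addP[_ /vlineP[c1 ->] [_ /vlineP[c2 ->] ->]]; exists c1, c2.
Qed.

Lemma derived_expand z :
  z \in derived br -> z = ip z e1 *: e1 + ip z e2 *: e2.
Proof.
move=> /span_frame[c1 [c2 ->]].
rewrite !linearDl /= !linearZl_LR /= !frameE.
by rewrite !mulr1 !mulr0 addr0 add0r.
Qed.

(** For all x, y the trace of ad [x, y] on g' is that of a commutator of
    endomorphisms of g', hence zero, so ad e1 and ad e2 are traceless on g'.
    Since ad e1 kills e1 and ad e2 kills e2, these two traces are the
    coordinates of [e1, e2], up to sign. *)
Lemma derived_abelian : br e1 e2 = 0.
Proof.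
(* The trace of ad z on g'. *)
pose tau z := ip (br z e1) e1 + ip (br z e2) e2.
have lin : linear (tau : V -> R^o).
  move=> a z z'; rewrite /tau !linearDl !linearZl_LR /=.
  by rewrite /GRing.scale /=; lra.
pose m := GRing.isLinear.Build _ _ _ _ _ lin.
pose tauL := HB.pack_for {linear V -> R^o} (tau : V -> R^o) m.
have tau_br x y : tau (br x y) = 0.
  have jac e : br (br x y) e = br x (br y e) - br y (br x e).
    rewrite (lie_anti br (br x y)); apply/eqP; rewrite eq_sym -subr_eq0 opprK.
    by rewrite -(lie_jacobi (s := br) x y e) (lie_anti br e x) linearNr.
  have ex z e : br z e = ip (br z e) e1 *: e1 + ip (br z e) e2 *: e2.
    exact/derived_expand/mem_derived.
  rewrite /tau !jac (ex y e1) (ex y e2) (ex x e1) (ex x e2).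
  rewrite !linearDr !linearZr_LR /= !linearBl !linearDl /= !linearZl_LR /=.
  by lra.
have tau0 : {in derived br, forall z, tau z = 0}.
  exact: (derived_vanish (f := tauL)).
have he1 : e1 \in derived br by rewrite (basis_mem e_basis) ?inE ?eqxx.
have he2 : e2 \in derived br by rewrite (basis_mem e_basis) ?inE ?eqxx ?orbT.
have := (tau0 _ he1, tau0 _ he2).
rewrite /tau !lie_alternating (lie_anti br e2) !linear0l linearNl /=.
rewrite addr0 add0r => -[c2 c1].
rewrite (derived_expand (mem_derived br e1 e2)) c2.
by move/eqP: c1; rewrite oppr_eq0 => /eqP ->; rewrite !scale0r addr0.
Qed.

Lemma perp_frame1 (u : subvs_of (derived_perp br ip)) : ip (vsval u) e1 = 0.
Proof.
have /mem_orthovP -> // := subvsP u.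
by rewrite (basis_mem e_basis) ?inE ?eqxx.
Qed.

Lemma perp_frame2 (u : subvs_of (derived_perp br ip)) : ip (vsval u) e2 = 0.
Proof.
have /mem_orthovP -> // := subvsP u.
by rewrite (basis_mem e_basis) ?inE ?eqxx ?orbT.
Qed.

Lemma frame_expand z : exists w : subvs_of (derived_perp br ip),
  z = vsval w + ip z e1 *: e1 + ip z e2 *: e2.
Proof.
pose w := z - (ip z e1 *: e1 + ip z e2 *: e2).
have wP : w \in derived_perp br ip.
  apply/mem_orthovP => _ /span_frame[c1 [c2 ->]].
  rewrite /w !linearBl !linearDl !linearDr /= !linearZl_LR !linearZr_LR /=.
  by rewrite !frameE; lra.
by exists (Subvs wP); rewrite /= /w -addrA subrK.
Qed.

(** The defining identity of a coadjoint vector is linear in z, so it can be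
    tested on g' and on its complement separately. *)
Lemma coadjoint_frame x y t :
  (forall w : subvs_of (derived_perp br ip),
    ip t (vsval w) = ip (br (vsval w) x) y) ->
  ip t e1 = ip (br e1 x) y -> ip t e2 = ip (br e2 x) y ->
  coadjoint br ip x y t.
Proof.
move=> hw h1 h2 z; have [w ->] := frame_expand z.
rewrite !linearDr !linearDl /= !linearZr_LR !linearZl_LR /=.
by rewrite hw h1 h2.
Qed.

Lemma coadjoint_perp x (u : subvs_of (derived_perp br ip)) :
  coadjoint br ip x (vsval u) 0.
Proof.
move=> z; rewrite linear0l dotC.
by have /mem_orthovP -> // := subvsP u; apply: mem_derived.
Qed.

(** As g' is abelian and x lies in it, both sides of the defining identity
    vanish on g', and only its complement has to be tested. *)
Lemma coadjoint_plane x y (c : subvs_of (derived_perp br ip)) :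
  x \in derived br ->
  (forall w : subvs_of (derived_perp br ip),
    ip (vsval c) (vsval w) = ip (br (vsval w) x) y) ->
  coadjoint br ip x y (vsval c).
Proof.
move=> /span_frame[c1 [c2 ->]] hc; have br12 := derived_abelian.
apply: coadjoint_frame => //; rewrite ?perp_frame1 ?perp_frame2;
  rewrite linearDr !linearZr_LR /= lie_alternating ?(lie_anti br e2) br12;
  by rewrite ?oppr0 !scaler0 addr0 linear0l.
Qed.

End DerivedPlane.

(** * The curvatures in terms of the structure constants *)

Section StructureConstants.
Context {R : realType} {V : vectType R}.
Variables (br : {lie V}) (ip : {dot V for idfun}).
Local Notation perp := (subvs_of (derived_perp br ip)).
Local Notation "''[' u , v ]" := (dot_on ip u v).

Definition derived_frame (e1 e2 : V) (a1 a2 b1 b2 : perp)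
    (f1 f2 : 'End(perp)) : Prop :=
  [/\ basis_of (derived br) [:: e1; e2] /\ orthonormal ip [:: e1; e2],
      (forall u v, '[f1 u, v] = - '[u, f1 v]) /\
      (forall u v, '[f2 u, v] = - '[u, f2 v]),
      forall u : perp, br (vsval u) e1 = '[a1, u] *: e1 + '[a2, u] *: e2,
      forall u : perp, br (vsval u) e2 = '[b1, u] *: e1 + '[b2, u] *: e2
    & forall u v : perp,
        br (vsval u) (vsval v) = '[f1 u, v] *: e1 + '[f2 u, v] *: e2].

(** This symmetry makes every formula about e1 yield the one about e2. *)
Lemma derived_frame_swap e1 e2 a1 a2 b1 b2 f1 f2 :
  derived_frame e1 e2 a1 a2 b1 b2 f1 f2 ->
  derived_frame e2 e1 b2 b1 a2 a1 f2 f1.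
Proof.
move=> [[eb eo] [s1 s2] h1 h2 hp]; split=> [|//|u|u|u v].
- split; last first.
    rewrite /orthonormal /= !andbT (frame11 eo) (frame22 eo) (frame21 eo).
    by rewrite !eqxx.
  have e21 : perm_eq [:: e2; e1] [:: e1; e2].
    by rewrite (perm_catC [:: e2] [:: e1]).
  by rewrite (perm_basis (derived br) e21).
- by rewrite addrC.
- by rewrite addrC.
- by rewrite addrC.
Qed.

Section Curvatures.
Variables (e1 e2 : V) (a1 a2 b1 b2 : perp) (f1 f2 : 'End(perp)).
Hypothesis frame : derived_frame e1 e2 a1 a2 b1 b2 f1 f2.

Let e_basis : basis_of (derived br) [:: e1; e2].
Proof. by case: frame => -[]. Qed.
Let e_orthonormal : orthonormal ip [:: e1; e2].
Proof. by case: frame => -[]. Qed.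
Let br_e1 u : br (vsval u) e1 = '[a1, u] *: e1 + '[a2, u] *: e2.
Proof. by case: frame. Qed.
Let br_e2 u : br (vsval u) e2 = '[b1, u] *: e1 + '[b2, u] *: e2.
Proof. by case: frame. Qed.
Let br_perp u v : br (vsval u) (vsval v) = '[f1 u, v] *: e1 + '[f2 u, v] *: e2.
Proof. by case: frame. Qed.
Let br12 : br e1 e2 = 0 := derived_abelian e_basis e_orthonormal.
Let br21 : br e2 e1 = 0. Proof. by rewrite lie_anti br12 oppr0. Qed.
Let e11 := frame11 e_orthonormal.
Let e22 := frame22 e_orthonormal.
Let e12 := frame12 e_orthonormal.
Let frameE := frameE e_orthonormal.
Let perp1 := perp_frame1 (ip := ip) e_basis.
Let perp2 := perp_frame2 (ip := ip) e_basis.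
Let perp1' u : ip e1 (vsval u) = 0 := etrans (dotC ip _ _) (perp1 u).
Let perp2' u : ip e2 (vsval u) = 0 := etrans (dotC ip _ _) (perp2 u).
Let perpE := (perp1, perp2, perp1', perp2').

Let e1_derived : e1 \in derived br.
Proof. by rewrite (basis_mem e_basis) ?inE ?eqxx. Qed.
Let e2_derived : e2 \in derived br.
Proof. by rewrite (basis_mem e_basis) ?inE ?eqxx ?orbT. Qed.

Let T11 : coadjoint br ip e1 e1 (vsval a1).
Proof.
apply: (coadjoint_plane e_basis e_orthonormal) => // w.
by rewrite br_e1 linearDl /= !linearZl_LR /= !frameE /dot_on; lra.
Qed.

Let T12 : coadjoint br ip e1 e2 (vsval a2).
Proof.
apply: (coadjoint_plane e_basis e_orthonormal) => // w.
by rewrite br_e1 linearDl /= !linearZl_LR /= !frameE /dot_on; lra.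
Qed.

Let T21 : coadjoint br ip e2 e1 (vsval b1).
Proof.
apply: (coadjoint_plane e_basis e_orthonormal) => // w.
by rewrite br_e2 linearDl /= !linearZl_LR /= !frameE /dot_on; lra.
Qed.

Let T22 : coadjoint br ip e2 e2 (vsval b2).
Proof.
apply: (coadjoint_plane e_basis e_orthonormal) => // w.
by rewrite br_e2 linearDl /= !linearZl_LR /= !frameE /dot_on; lra.
Qed.

(** The component in the complement of g' comes from
    <[w, u], e1> = <f1 w, u> = - <w, f1 u>, the others from
    [e_i, u] = - [u, e_i]. *)
Lemma coadjoint_ue1 u : coadjoint br ip (vsval u) e1
  (- (vsval (f1 u) + '[a1, u] *: e1 + '[b1, u] *: e2)).
Proof.
have f1_skew : forall u v, '[f1 u, v] = - '[u, f1 v] by case: frame => _ [].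
apply: (coadjoint_frame e_basis e_orthonormal) => [w||].
- rewrite br_perp linearNl !linearDl /= !linearZl_LR /= !frameE.
  rewrite [ip e1 _]dotC [ip e2 _]dotC perp1 perp2 f1_skew.
  by rewrite /dot_on [ip (vsval w) _]dotC; lra.
- rewrite (lie_anti br e1) br_e1 !linearNl /= !linearDl /= !linearZl_LR /=.
  by rewrite !frameE perp1; lra.
- rewrite (lie_anti br e2) br_e2 !linearNl /= !linearDl /= !linearZl_LR /=.
  by rewrite !frameE perp2; lra.
Qed.

Local Notation K := (lifted_curvature br ip).

Lemma curvature_e1c_e2c :
  K (clift e1) (clift e2) = 1 / 4 * '[a2 + b1, a2 + b1] - '[a1, b2].
Proof.
rewrite (lifted_curvature_cc T11 T22 T12 T21 e11 e22 e12) br12 br21.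
by rewrite !linear0r !linear0l /dot_on raddfD /=; lra.
Qed.

Lemma curvature_e1v_e2v :
  K (vlift e1) (vlift e2) = 1 / 4 * '[a2 + b1, a2 + b1] - '[a1, b2].
Proof.
by rewrite (lifted_curvature_vv T11 T22 T12 T21 e11 e22 e12) /dot_on raddfD.
Qed.

Lemma curvature_e1c_e2v :
  K (clift e1) (vlift e2) = 1 / 4 * '[a2, a2] - '[a1, b2].
Proof.
rewrite (lifted_curvature_cv T11 T22 T12 e11 e22) br12.
by rewrite !linear0r !linear0l /dot_on; lra.
Qed.

Lemma curvature_e1v_e2c :
  K (vlift e1) (clift e2) = 1 / 4 * '[b1, b1] - '[a1, b2].
Proof.
rewrite (lifted_curvature_vc T11 T22 T21 e11 e22) br12 br21.
by rewrite !linear0r !linear0l /dot_on; lra.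
Qed.

Lemma curvature_e1c_e1v : K (clift e1) (vlift e1) = - (3 / 4) * '[a1, a1].
Proof.
rewrite (lifted_curvature_cv T11 T11 T11 e11 e11) lie_alternating.
by rewrite !linear0r !linear0l /dot_on; lra.
Qed.

Section PerpPlane.
Variables u w : perp.
Hypotheses (uu : '[u, u] = 1) (ww : '[w, w] = 1).

Let T0 x v := coadjoint_perp (br := br) (ip := ip) x v.

Lemma curvature_uv_wv :
  '[u, w] = 0 -> K (vlift (vsval u)) (vlift (vsval w)) = 0.
Proof.
move=> uw.
rewrite (lifted_curvature_vv (T0 _ _) (T0 _ _) (T0 _ _) (T0 _ _) uu ww uw).
by rewrite addr0 !linear0l mulr0 subr0.
Qed.

Lemma curvature_uc_wv : K (clift (vsval u)) (vlift (vsval w)) =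
  - (3 / 4) * ('[f1 u, w] ^+ 2 + '[f2 u, w] ^+ 2).
Proof.
rewrite (lifted_curvature_cv (T0 _ _) (T0 _ _) (T0 _ _) uu ww) br_perp.
rewrite !(linearDl, linearDr) /= !(linearZl_LR, linearZr_LR) /=.
rewrite br_e1 br_e2 !linearDl /= !linearZl_LR /= !frameE !perpE !linear0l.
by lra.
Qed.

Lemma curvature_uc_wc : '[u, w] = 0 -> K (clift (vsval u)) (clift (vsval w)) =
  - (3 / 4) * ('[f1 u, w] ^+ 2 + '[f2 u, w] ^+ 2).
Proof.
move=> uw.
rewrite (lifted_curvature_cc (T0 _ _) (T0 _ _) (T0 _ _) (T0 _ _) uu ww uw).
have perp_br x y (v : perp) : ip (br x y) (vsval v) = 0.
  by rewrite -(T0 y v) linear0l.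
rewrite !perp_br addr0 !linear0l br_perp.
rewrite !(linearDl, linearDr) /= !(linearZl_LR, linearZr_LR) /= !frameE.
by lra.
Qed.

End PerpPlane.

Section MixedPlane.
Variable u : perp.
Hypothesis uu : '[u, u] = 1.

Let Tuu := coadjoint_perp (br := br) (ip := ip) (vsval u) u.
Let T1u := coadjoint_perp (br := br) (ip := ip) e1 u.
Let Tu1 := coadjoint_ue1 u.

Let T := - (vsval (f1 u) + '[a1, u] *: e1 + '[b1, u] *: e2).

Let sqnormT : ip T T = '[f1 u, f1 u] + '[a1, u] ^+ 2 + '[b1, u] ^+ 2.
Proof.
rewrite /T linearNl linearNr /= opprK !(linearDl, linearDr) /=.
by rewrite !(linearZl_LR, linearZr_LR) /= !frameE !perpE /dot_on; lra.
Qed.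

Let sqnorm_br : ip (br (vsval u) e1) (br (vsval u) e1) =
  '[a1, u] ^+ 2 + '[a2, u] ^+ 2.
Proof.
rewrite br_e1 !(linearDl, linearDr) /=.
by rewrite !(linearZl_LR, linearZr_LR) /= !frameE; lra.
Qed.

Let br_br : ip (br (vsval u) (br (vsval u) e1)) e1 =
  '[a1, u] ^+ 2 + '[a2, u] * '[b1, u].
Proof.
rewrite br_e1 linearDr !linearZr_LR /= br_e1 br_e2.
rewrite !linearDl /= !linearZl_LR /= !linearDl /= !linearZl_LR /=.
by rewrite !frameE; lra.
Qed.

Let br_e1_e1 : br e1 (br e1 (vsval u)) = 0.
Proof.
rewrite (lie_anti br e1 (vsval u)) br_e1 !(linearNr, linearDr) /=.
by rewrite !linearZr_LR /= br12 lie_alternating !scaler0 addr0 oppr0.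
Qed.

Let dot_coeffs : 1 / 4 * '[u, a2 + b1] * '[u, b1 - 3 *: a2] =
  1 / 4 * ('[a2, u] + '[b1, u]) * ('[b1, u] - 3 * '[a2, u]).
Proof.
rewrite /dot_on !(linearDr, linearBr) /= linearN linearZ /=.
by rewrite ![ip (vsval u) _]dotC.
Qed.

Lemma curvature_uc_uv : K (clift (vsval u)) (vlift (vsval u)) = 0.
Proof.
rewrite (lifted_curvature_cv Tuu Tuu Tuu uu uu) lie_alternating.
by rewrite !linear0r !linear0l; lra.
Qed.

Lemma curvature_uc_e1c : K (clift (vsval u)) (clift e1) =
  1 / 4 * '[f1 u, f1 u] - '[a1, u] ^+ 2
  + 1 / 4 * '[u, a2 + b1] * '[u, b1 - 3 *: a2].
Proof.
rewrite (lifted_curvature_cc Tuu T11 Tu1 T1u uu e11 (perp1 u)).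
rewrite addr0 sqnormT sqnorm_br br_br br_e1_e1 !linear0l dot_coeffs.
by lra.
Qed.

Lemma curvature_uc_e1v : K (clift (vsval u)) (vlift e1) =
  1 / 4 * '[f1 u, f1 u] - '[a1, u] ^+ 2
  + 1 / 4 * '[u, a2 + b1] * '[u, b1 - 3 *: a2].
Proof.
rewrite (lifted_curvature_cv Tuu T11 Tu1 uu e11).
by rewrite sqnormT sqnorm_br br_br !linear0l dot_coeffs; lra.
Qed.

Lemma curvature_uv_e1c : K (vlift (vsval u)) (clift e1) =
  - (3 / 4) * ('[a1, u] ^+ 2 + '[a2, u] ^+ 2).
Proof.
rewrite (lifted_curvature_vc Tuu T11 T1u uu e11).
by rewrite sqnorm_br br_e1_e1 !linear0l; lra.
Qed.

Lemma curvature_uv_e1v : K (vlift (vsval u)) (vlift e1) =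
  1 / 4 * ('[f1 u, f1 u] + '[a1, u] ^+ 2 + '[b1, u] ^+ 2).
Proof.
rewrite (lifted_curvature_vv Tuu T11 Tu1 T1u uu e11 (perp1 u)).
by rewrite addr0 sqnormT linear0l subr0.
Qed.

End MixedPlane.
End Curvatures.
End StructureConstants.

Theorem theorem3p2 (R : realType) (V : vectType R)
    (br : {lie V}) (ip : {dot V for idfun})
    (dim_derived : \dim (derived br) = 2%N)
    (e1 e2 : V)
    (e_basis : basis_of (derived br) [:: e1; e2])
    (e_orthonormal : orthonormal ip [:: e1; e2])
    (a1 a2 b1 b2 : subvs_of (derived_perp br ip))
    (f1 f2 : 'End(subvs_of (derived_perp br ip)))
    (f1_skew : forall u v, dot_on ip (f1 u) v = - dot_on ip u (f1 v))
    (f2_skew : forall u v, dot_on ip (f2 u) v = - dot_on ip u (f2 v))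
    (br_e1 : forall u : subvs_of (derived_perp br ip),
      br (vsval u) e1 = dot_on ip a1 u *: e1 + dot_on ip a2 u *: e2)
    (br_e2 : forall u : subvs_of (derived_perp br ip),
      br (vsval u) e2 = dot_on ip b1 u *: e1 + dot_on ip b2 u *: e2)
    (br_perp : forall u v : subvs_of (derived_perp br ip),
      br (vsval u) (vsval v) =
        dot_on ip (f1 u) v *: e1 + dot_on ip (f2 u) v *: e2) :
  let K := lifted_curvature br ip in
  let e1c := clift e1 in let e2c := clift e2 in
  let e1v := vlift e1 in let e2v := vlift e2 in
  let c (u : subvs_of (derived_perp br ip)) := clift (vsval u) in
  let v (u : subvs_of (derived_perp br ip)) := vlift (vsval u) in
  let dot (x y : subvs_of (derived_perp br ip)) := dot_on ip x y in
  let sqnorm (x : subvs_of (derived_perp br ip)) := dot_on ip x x in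
  [/\ K e1c e2c = 1 / 4 * sqnorm (a2 + b1) - dot a1 b2
        /\ K e1v e2v = 1 / 4 * sqnorm (a2 + b1) - dot a1 b2,
      K e1c e2v = 1 / 4 * sqnorm a2 - dot a1 b2,
      K e1c e1v = - (3 / 4) * sqnorm a1,
      K e1v e2c = 1 / 4 * sqnorm b1 - dot a1 b2
    & K e2c e2v = - (3 / 4) * sqnorm b2]
  /\ (forall u w : subvs_of (derived_perp br ip),
        dot u u = 1 -> dot w w = 1 -> dot u w = 0 ->
        K (v u) (v w) = 0
        /\ K (c u) (c w)
             = - (3 / 4) * (dot (f1 u) w ^+ 2 + dot (f2 u) w ^+ 2)
        /\ K (c u) (v w)
             = - (3 / 4) * (dot (f1 u) w ^+ 2 + dot (f2 u) w ^+ 2))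
  /\ (forall u : subvs_of (derived_perp br ip),
        dot u u = 1 ->
        [/\ K (c u) (v u) = 0,
            K (c u) e1c
              = 1 / 4 * sqnorm (f1 u) - dot a1 u ^+ 2
                + 1 / 4 * dot u (a2 + b1) * dot u (b1 - 3 *: a2)
            /\ K (c u) e1v
              = 1 / 4 * sqnorm (f1 u) - dot a1 u ^+ 2
                + 1 / 4 * dot u (a2 + b1) * dot u (b1 - 3 *: a2),
            K (c u) e2c
              = 1 / 4 * sqnorm (f2 u) - dot b2 u ^+ 2
                + 1 / 4 * dot u (a2 + b1) * dot u (a2 - 3 *: b1)
            /\ K (c u) e2v
              = 1 / 4 * sqnorm (f2 u) - dot b2 u ^+ 2
                + 1 / 4 * dot u (a2 + b1) * dot u (a2 - 3 *: b1),
            K (v u) e1c = - (3 / 4) * (dot a1 u ^+ 2 + dot a2 u ^+ 2)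
            /\ K (v u) e1v
              = 1 / 4 * (sqnorm (f1 u) + dot a1 u ^+ 2 + dot b1 u ^+ 2)
          & K (v u) e2c = - (3 / 4) * (dot b1 u ^+ 2 + dot b2 u ^+ 2)
            /\ K (v u) e2v
              = 1 / 4 * (sqnorm (f2 u) + dot a2 u ^+ 2 + dot b2 u ^+ 2)]).
Proof.
move=> K e1c e2c e1v e2v c v dot sqnorm.
have frame : derived_frame e1 e2 a1 a2 b1 b2 f1 f2 by [].
have frame' := derived_frame_swap frame.
split; last split.
- split; first split.
  + exact: (curvature_e1c_e2c frame).
  + exact: (curvature_e1v_e2v frame).
  + exact: (curvature_e1c_e2v frame).
  + exact: (curvature_e1c_e1v frame).
  + exact: (curvature_e1v_e2c frame).
  + exact: (curvature_e1c_e1v frame').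
- move=> u w uu ww uw; split; last split.
  + exact: curvature_uv_wv.
  + exact: (curvature_uc_wc frame).
  + exact: (curvature_uc_wv frame).
- move=> u uu; split; try split.
  + exact: curvature_uc_uv.
  + exact: (curvature_uc_e1c frame).
  + exact: (curvature_uc_e1v frame).
  + by rewrite [a2 + b1]addrC; exact: (curvature_uc_e1c frame').
  + by rewrite [a2 + b1]addrC; exact: (curvature_uc_e1v frame').
  + exact: (curvature_uv_e1c frame).
  + exact: (curvature_uv_e1v frame).
  + by rewrite [_ + dot b2 u ^+ 2]addrC; exact: (curvature_uv_e1c frame').
  + by rewrite [_ + dot b2 u ^+ 2]addrAC; exact: (curvature_uv_e1v frame').
Qed.
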